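(* Let $a,b\in\mathbb{R}^4$, $\alpha\in\mathbb{R}\setminus\{0\}$, $A\in O(4)$, $\varepsilon\in\{0,2\}$, and consider the Möbius transformation $$\phi(x)=a+\frac{\alpha A(x-b)}{|x-b|^{\varepsilon}},$$ defined on $\mathbb{R}^4$ if $\varepsilon=0$ and on $\mathbb{R}^4\setminus\{b\}$ if $\varepsilon=2$, where the domain carries the Euclidean metric $dx^2$. Then: (1) Viewed as a map into Euclidean space $(\mathbb{R}^4,dx^2)$, $\phi$ is biharmonic, and it is proper biharmonic if and only if $\varepsilon\neq0$. (2) Viewed as a map into the standard sphere $S^4$, i.e. into $\mathbb{R}^4$ with the spherical metric $g_S=\frac{4\,dx^2}{(1+|x|^2)^2}$, $\phi$ is always proper biharmonic.
   Context: For a smooth map $\phi:(M,g)\to(N,h)$ between Riemannian manifolds, the tension field is $\tau(\phi)=\mathrm{Tr}_g\nabla d\phi$; $\phi$ is harmonic if $\tau(\phi)\equiv0$. The map $\phi$ is biharmonic if $$-\mathrm{Tr}_g(\nabla^\phi)^2\tau(\phi)-\mathrm{Tr}_g R^N(\tau(\phi),d\phi)d\phi=0,$$ where $\nabla^\phi$ is the pull-back connection on $\phi^{-1}TN$ and $R^N$ is the Riemannian curvature of $N$ with the convention $R(X,Y)Z=\nabla_X\nabla_YZ-\nabla_Y\nabla_XZ-\nabla_{[X,Y]}Z$. A map is proper biharmonic if it is biharmonic but not harmonic. The standard sphere $S^4$ is identified with $\mathbb{R}^4\cup\{\infty\}$ via stereographic projection, under which its metric is $g_S$ on $\mathbb{R}^4$.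 *)

(* Defs.v *)
From HB Require Import structures.
From mathcomp Require Import all_boot all_order all_algebra.
From mathcomp Require Import all_classical all_reals all_analysis.

Set Implicit Arguments.
Unset Strict Implicit.
Unset Printing Implicit Defensive.

Import Order.TTheory GRing.Theory Num.Theory.
Import numFieldNormedType.Exports.

Local Open Scope classical_set_scope.
Local Open Scope ring_scope.

(** Riemannian manifolds covered by a single chart: the manifold is (an open
    subset of) 'cV[R]_n and a Riemannian metric is given by its matrix of
    coefficients, i.e. a field of symmetric positive definite matrices
    [g : 'cV[R]_n -> 'M[R]_n].  Tangent vectors are identified with 'cV[R]_n
    through the coordinate frame. *)

(** The library's norm on matrices is the sup norm, hence this definition. *)
Definition enorm (R : realType) (n : nat) (x : 'cV[R]_n) : R :=
  Num.sqrt (\sum_i x i 0 ^+ 2).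

Definition frame (R : realType) (n : nat) (i : 'I_n) : 'cV[R]_n :=
  delta_mx i 0.
Arguments frame {R n} i.

(** Smoothness on an open set [U]: all iterated partial derivatives, of any
    order, are differentiable at every point of [U]. *)
Definition iter_partial (R : realType) (m n : nat) (s : seq 'I_m)
    (f : 'cV[R]_m -> 'cV[R]_n) : 'cV[R]_m -> 'cV[R]_n :=
  foldr (fun i h => fun x => 'D_(frame i) h x) f s.

Definition smooth_on (R : realType) (m n : nat) (U : set 'cV[R]_m)
    (f : 'cV[R]_m -> 'cV[R]_n) : Prop :=
  forall (s : seq 'I_m) (x : 'cV[R]_m), U x ->
    differentiable (iter_partial s f) x.

Section Connection.
Context {R : realType} {n : nat} (g : 'cV[R]_n -> 'M[R]_n).

(** [christoffel k i j y] is Gamma^k_ij(y) for the Levi-Civita connection. *)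
Definition christoffel (k i j : 'I_n) (y : 'cV[R]_n) : R :=
  2^-1 * \sum_l invmx (g y) k l *
    ('D_(frame i) (fun z => g z j l) y + 'D_(frame j) (fun z => g z i l) y
     - 'D_(frame l) (fun z => g z i j) y).

(** Bilinear extension of [nabla_(e_i) e_j] to the vectors [u] and [v] at [y]. *)
Definition christoffel_form (y u v : 'cV[R]_n) : 'cV[R]_n :=
  \col_k \sum_i \sum_j christoffel k i j y * u i 0 * v j 0.

Definition nabla (X Z : 'cV[R]_n -> 'cV[R]_n) (y : 'cV[R]_n) : 'cV[R]_n :=
  'D_(X y) Z y + christoffel_form y (X y) (Z y).

Definition lie_bracket (X Y : 'cV[R]_n -> 'cV[R]_n) (y : 'cV[R]_n) : 'cV[R]_n :=
  'D_(X y) Y y - 'D_(Y y) X y.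

Definition curvature (X Y Z : 'cV[R]_n -> 'cV[R]_n) (y : 'cV[R]_n) : 'cV[R]_n :=
  nabla X (nabla Y Z) y - nabla Y (nabla X Z) y - nabla (lie_bracket X Y) Z y.

(** The curvature is tensorial: its value on three tangent vectors at [y] is
    computed by extending them to vector fields with constant coefficients. *)
Definition curvature_at (y u v w : 'cV[R]_n) : 'cV[R]_n :=
  curvature (cst u) (cst v) (cst w) y.

End Connection.

Section Maps.
Context {R : realType} {m n : nat}.
Context (g : 'cV[R]_m -> 'M[R]_m) (h : 'cV[R]_n -> 'M[R]_n).
Context (phi : 'cV[R]_m -> 'cV[R]_n).

Definition trace_g (x : 'cV[R]_m) (B : 'I_m -> 'I_m -> 'cV[R]_n) : 'cV[R]_n :=
  \sum_i \sum_j invmx (g x) i j *: B i j.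

Definition dmap (v x : 'cV[R]_m) : 'cV[R]_n := 'D_v phi x.

(** Pull-back connection: [V] is a section of phi^{-1} TN. *)
Definition nabla_pull (v : 'cV[R]_m) (V : 'cV[R]_m -> 'cV[R]_n)
    (x : 'cV[R]_m) : 'cV[R]_n :=
  'D_v V x + christoffel_form h (phi x) (dmap v x) (V x).

Definition nabla_frame (i j : 'I_m) (x : 'cV[R]_m) : 'cV[R]_m :=
  nabla g (cst (frame i)) (cst (frame j)) x.

(** (nabla dphi)(e_i, e_j) *)
Definition second_fundamental_form (i j : 'I_m) (x : 'cV[R]_m) : 'cV[R]_n :=
  nabla_pull (frame i) (dmap (frame j)) x - dmap (nabla_frame i j x) x.

Definition tension (x : 'cV[R]_m) : 'cV[R]_n :=
  trace_g x (fun i j => second_fundamental_form i j x).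

(** Second covariant derivative ((nabla^phi)^2 V)(e_i, e_j). *)
Definition nabla2_pull (V : 'cV[R]_m -> 'cV[R]_n) (i j : 'I_m)
    (x : 'cV[R]_m) : 'cV[R]_n :=
  nabla_pull (frame i) (nabla_pull (frame j) V) x
  - nabla_pull (nabla_frame i j x) V x.

Definition bitension (x : 'cV[R]_m) : 'cV[R]_n :=
  - trace_g x (fun i j => nabla2_pull tension i j x)
  - trace_g x (fun i j =>
      curvature_at h (phi x) (tension x) (dmap (frame i) x) (dmap (frame j) x)).

Definition harmonic (U : set 'cV[R]_m) : Prop :=
  smooth_on U phi /\ forall x, U x -> tension x = 0.

Definition biharmonic (U : set 'cV[R]_m) : Prop :=
  smooth_on U phi /\ forall x, U x -> bitension x = 0.

Definition proper_biharmonic (U : set 'cV[R]_m) : Prop :=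
  biharmonic U /\ ~ harmonic U.

End Maps.

Definition euclidean_metric (R : realType) (n : nat) (_ : 'cV[R]_n) : 'M[R]_n :=
  1%:M.

(** Round metric of the unit sphere in stereographic coordinates. *)
Definition spherical_metric (R : realType) (n : nat) (y : 'cV[R]_n) : 'M[R]_n :=
  (4 / (1 + enorm y ^+ 2) ^+ 2)%:M.

Arguments euclidean_metric {R n} _.
Arguments spherical_metric {R n} _.

Definition mobius (R : realType) (n : nat) (a b : 'cV[R]_n) (alpha : R)
    (A : 'M[R]_n) (eps : nat) (x : 'cV[R]_n) : 'cV[R]_n :=
  a + (enorm (x - b) ^+ eps)^-1 *: (alpha *: (A *m (x - b))).

Definition mobius_domain (R : realType) (n : nat) (b : 'cV[R]_n) (eps : nat) :
    set 'cV[R]_n :=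
  if eps == 0%N then setT else ~` [set b].

(* Main.v *)
Require Import Defs.
From HB Require Import structures.
From mathcomp Require Import all_boot all_order all_algebra.
From mathcomp Require Import all_classical all_reals all_analysis.
From mathcomp Require Import ring lra.

Import Order.TTheory GRing.Theory Num.Theory.
Import numFieldNormedType.Exports.

Local Open Scope classical_set_scope.
Local Open Scope ring_scope.

(** The flat and the round metrics are both conformal to the flat one, with
    conformal factor proportional to [(1 + k |y|^2)^-2] for [k = 0] or
    [k = 1].  A Moebius map [phi] is conformal, so the pull-back by [phi] of such
    a metric is again conformally flat on the domain, with conformal factor
    proportional to [Q^-2]; here [Q] is a quadratic polynomial
    [c |x - b|^2 + <d, x - b> + e] with [|grad Q|^2 = 4 c Q - 4 k alpha^2].
    With [p = - grad Q / Q], the pull-back connection acts on [dphi (w)] as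
    [D_u w + <p, u> w + <p, w> u - <u, w> p], the tension field is
    [(2 - 4) dphi (p)], and the target has constant curvature.  In dimension 4
    the rough Laplacian of [p] cancels the curvature term because of the identity
    satisfied by [|grad Q|^2].  The map is harmonic iff [Q] is constant. *)

(** * The Euclidean inner product on column vectors *)

Section DotProduct.
Context {R : realType} {n : nat}.
Implicit Types (u v w : 'cV[R]_n) (a : R).

Definition dot u v : R := \sum_i u i 0 * v i 0.

Lemma dotC u v : dot u v = dot v u.
Proof. by apply: eq_bigr => i _; rewrite mulrC. Qed.

Lemma dotDl u v w : dot (u + v) w = dot u w + dot v w.
Proof. by rewrite -big_split; apply: eq_bigr => i _; rewrite mxE mulrDl. Qed.

Lemma dotZl a u v : dot (a *: u) v = a * dot u v.
Proof. by rewrite mulr_sumr; apply: eq_bigr => i _; rewrite mxE mulrA. Qed.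

Lemma dotNl u v : dot (- u) v = - dot u v.
Proof. by rewrite -scaleN1r dotZl mulN1r. Qed.

Lemma dotDr u v w : dot w (u + v) = dot w u + dot w v.
Proof. by rewrite dotC dotDl !(dotC w). Qed.

Lemma dotZr a u v : dot v (a *: u) = a * dot v u.
Proof. by rewrite dotC dotZl dotC. Qed.

Lemma dotNr u v : dot v (- u) = - dot v u.
Proof. by rewrite dotC dotNl dotC. Qed.

Lemma dot0l v : dot 0 v = 0.
Proof. by rewrite -(scale0r 0) dotZl mul0r. Qed.

Lemma dot0r v : dot v 0 = 0.
Proof. by rewrite dotC dot0l. Qed.

Definition dotE := (dotDl, dotDr, dotZl, dotZr, dotNl, dotNr).

Lemma dot_frame v i : dot v (frame i) = v i 0.
Proof.
rewrite /dot (bigD1 i)//= big1 ?addr0 => [|j ji].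
  by rewrite mxE !eqxx mulr1.
by rewrite mxE (negbTE ji) mulr0.
Qed.

Lemma dot_mulmx u v : u^T *m v = (dot u v)%:M.
Proof.
apply/matrixP => i j; rewrite !ord1 !mxE mulr1n.
by apply: eq_bigr => l _; rewrite mxE.
Qed.

Lemma dot_ge0 v : 0 <= dot v v.
Proof. by apply: sumr_ge0 => i _; rewrite -expr2 sqr_ge0. Qed.

Lemma dot_eq0 v : (dot v v == 0) = (v == 0).
Proof.
apply/idP/eqP => [|->]; last by rewrite dot0l.
rewrite psumr_eq0 => [/allP v0|i _]; last by rewrite -expr2 sqr_ge0.
apply/matrixP => i j; rewrite ord1 mxE; apply/eqP.
by have := v0 i (mem_index_enum _); rewrite -expr2 sqrf_eq0.
Qed.

Lemma enorm_sqr v : enorm v ^+ 2 = dot v v.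
Proof.
rewrite sqr_sqrtr; first by apply: eq_bigr => i _; rewrite expr2.
by apply: sumr_ge0 => i _; rewrite sqr_ge0.
Qed.

Lemma sum_dot_frame v : \sum_i dot v (frame i) *: frame i = v.
Proof.
apply/matrixP => i j; rewrite ord1 summxE (bigD1 i)//= big1 ?addr0 => [|l li].
  by rewrite dot_frame !mxE !eqxx mulr1.
by rewrite !mxE eq_sym (negbTE li) mulr0.
Qed.

Lemma sum_dot_frame_sqr v : \sum_i dot v (frame i) ^+ 2 = dot v v.
Proof. by apply: eq_bigr => i _; rewrite dot_frame expr2. Qed.

Lemma dot_frameii i : dot (frame i) (frame i) = 1.
Proof. by rewrite dot_frame mxE !eqxx. Qed.

End DotProduct.

Lemma dot_adj {R : realType} {m n : nat} (M : 'M[R]_(m, n)) u v :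
  dot (M *m u) v = dot u (M^T *m v).
Proof.
have : (dot (M *m u) v)%:M = (dot u (M^T *m v))%:M :> 'M[R]_1.
  by rewrite -!dot_mulmx trmx_mul mulmxA.
by move/matrixP => /(_ 0 0); rewrite !mxE !mulr1n.
Qed.

(** * Product and quotient rules for directional derivatives of matrix-valued maps *)

Section Derivatives.
Context {R : realType} {d : nat}.
Implicit Types (x v : 'cV[R]_d).

Lemma is_derive_mx {m n} (F : 'cV[R]_d -> 'M[R]_(m, n)) x v (dF : 'M[R]_(m, n)) :
  (forall i j, is_derive x v (fun z => F z i j) (dF i j)) ->
  is_derive x v F dF.
Proof.
move=> FE; have dvF : derivable F x v.
  by apply/derivable_mxP => i j; exact: ex_derive.
apply: DeriveDef => //; rewrite derive_mx//; apply/matrixP => i j.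
by rewrite mxE derive_val.
Qed.

Lemma is_derive_entry {m n} (F : 'cV[R]_d -> 'M[R]_(m, n)) x v (dF : 'M[R]_(m, n)) i j :
  is_derive x v F dF -> is_derive x v (fun z => F z i j) (dF i j).
Proof.
move=> [dvF <-]; apply: DeriveDef; first by move/derivable_mxP: dvF.
by rewrite derive_mx// mxE.
Qed.

Lemma is_derive_mul (f g : 'cV[R]_d -> R) x v df dg :
  is_derive x v f df -> is_derive x v g dg ->
  is_derive x v (fun z => f z * g z) (df * g x + f x * dg).
Proof.
by move=> ? ?; apply: is_derive_eq; rewrite addrC (mulrC df).
Qed.

Lemma is_derive_inv (f : 'cV[R]_d -> R) x v df :
  f x != 0 -> is_derive x v f df ->
  is_derive x v (fun z => (f z)^-1) (- df / f x ^+ 2).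
Proof.
move=> f0 [dvf <-]; apply: DeriveDef; first exact: derivableV.
by rewrite deriveV// scaleNr mulNr; congr (- _); rewrite /GRing.scale/= mulrC.
Qed.

Lemma is_derive_bigsum {W : normedModType R} n (h : 'I_n -> 'cV[R]_d -> W) x v dh :
  (forall i, is_derive x v (h i) (dh i)) ->
  is_derive x v (fun z => \sum_(i < n) h i z) (\sum_(i < n) dh i).
Proof.
move=> hE; rewrite (_ : (fun z => _) = \sum_(i < n) h i); first exact: is_derive_sum.
by apply/funext => z; rewrite fct_sumE.
Qed.

Lemma is_derive_mulmx {m n p} (F : 'cV[R]_d -> 'M[R]_(m, n))
    (G : 'cV[R]_d -> 'M[R]_(n, p)) x v dF dG :
  is_derive x v F dF -> is_derive x v G dG ->
  is_derive x v (fun z => F z *m G z) (dF *m G x + F x *m dG).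
Proof.
move=> FE GE; apply: is_derive_mx => i j.
under eq_fun do rewrite mxE.
apply: is_derive_eq.
  apply: is_derive_bigsum => l; apply: is_derive_mul; exact: is_derive_entry.
by rewrite !mxE -big_split.
Qed.

Lemma is_derive_scale {m n} (f : 'cV[R]_d -> R) (F : 'cV[R]_d -> 'M[R]_(m, n))
    x v df dF :
  is_derive x v f df -> is_derive x v F dF ->
  is_derive x v (fun z => f z *: F z) (df *: F x + f x *: dF).
Proof.
move=> fE FE; apply: is_derive_mx => i j.
under eq_fun do rewrite mxE.
apply: is_derive_eq.
  by apply: is_derive_mul; exact: is_derive_entry.
by rewrite !mxE.
Qed.

Lemma is_derive_dot {n} (F G : 'cV[R]_d -> 'cV[R]_n) x v dF dG :
  is_derive x v F dF -> is_derive x v G dG ->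
  is_derive x v (fun z => dot (F z) (G z)) (dot dF (G x) + dot (F x) dG).
Proof.
move=> FE GE; apply: is_derive_eq.
  apply: is_derive_bigsum => l; apply: is_derive_mul; exact: is_derive_entry.
by rewrite -big_split.
Qed.

End Derivatives.

(** * The Levi-Civita connection of a conformally flat metric *)

Section ConformalConnection.
Context {R : realType} {n : nat}.
Implicit Types (q u v w y : 'cV[R]_n).

(** The difference between the Levi-Civita connection of [exp (2 f) dx^2] and the flat one, where
    [q = grad f]. *)
Definition conf q u v : 'cV[R]_n :=
  dot q u *: v + dot q v *: u - dot u v *: q.

Lemma conf0l q v : conf q 0 v = 0.
Proof. by rewrite /conf dot0r dot0l scaler0 !scale0r !addr0 subr0. Qed.

Lemma conf0 u v : conf 0 u v = 0.
Proof. by rewrite /conf !dot0l !scale0r scaler0 !addr0 subr0. Qed.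

Lemma is_derive_conf {d} (q u v : 'cV[R]_d -> 'cV[R]_n) x z dq du dv :
  is_derive x z q dq -> is_derive x z u du -> is_derive x z v dv ->
  is_derive x z (fun t => conf (q t) (u t) (v t))
    (conf dq (u x) (v x) + conf (q x) du (v x) + conf (q x) (u x) dv).
Proof.
move=> qE uE vE; apply: is_derive_eq.
  apply: is_deriveB; first apply: is_deriveD.
  - by apply: is_derive_scale; first exact: is_derive_dot.
  - by apply: is_derive_scale; first exact: is_derive_dot.
  - by apply: is_derive_scale; first exact: is_derive_dot.
by apply/matrixP => i j; rewrite !(mxE, dotE); ring.
Qed.

(** With [e = exp (2 f)], the last hypothesis says that [q = grad f] at the single point [y]. Each
    Christoffel symbol is then a sum of three Kronecker deltas weighted by entries of [q], and each
    delta collapses one of the two sums. *)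
Lemma christoffel_form_conformal (h : 'cV[R]_n -> 'M[R]_n)
    (e : 'cV[R]_n -> R) q y u v :
  (forall z, h z = (e z)%:M) -> e y != 0 ->
  (forall z, is_derive y z e (2 * e y * dot q z)) ->
  christoffel_form h y u v = conf q u v.
Proof.
move=> hE e0 eE.
have dh i j l : 'D_(frame i) (fun z => h z j l) y
    = 2 * e y * q i 0 * (j == l)%:R.
  under eq_fun do rewrite hE mxE -mulr_natr.
  have ? := is_derive_mul _ _ _ _ _ _ (eE (frame i)) (is_derive_cst ((j == l)%:R : R) y _).
  by rewrite derive_val /= mulr0 addr0 dot_frame.
have christoffelE k i j : christoffel h k i j y =
    q i 0 * (k == j)%:R + q j 0 * (k == i)%:R - q k 0 * (i == j)%:R.
  rewrite /christoffel (bigD1 k)//= big1 => [|l lk]; last first.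
    by rewrite hE invmx_scalar mxE eq_sym (negbTE lk) mul0r.
  rewrite !dh hE invmx_scalar mxE eqxx mulr1n (eq_sym j) (eq_sym i k).
  by field.
apply/matrixP => k j'; rewrite ord1 /conf !mxE.
under eq_bigr => i _.
  under eq_bigr => j _ do
    rewrite christoffelE mulrDl mulrDl mulrDl mulrDl mulNr mulNr.
  rewrite sumrB big_split/= (bigD1 k)//= big1 ?addr0 => [|j jk]; last first.
    by rewrite eq_sym (negbTE jk) mulr0 !mul0r.
  rewrite (bigD1 (P := fun=> true) (F := fun j => q k 0 * _ * _ * _) i)//=.
  rewrite [X in _ - (_ + X)]big1 ?addr0 => [|j ji]; last first.
    by rewrite eq_sym (negbTE ji) mulr0 !mul0r.
  over.
rewrite sumrB big_split/=.
rewrite /dot; congr (_ + _ - _).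
- by rewrite mulr_suml; apply: eq_bigr => i _; rewrite eqxx mulr1.
- rewrite (bigD1 k)//= [X in _ + X]big1 ?addr0 => [|i ik].
    by rewrite mulr_suml; apply: eq_bigr => i _; rewrite eqxx mulr1 mulrAC.
  by apply: big1 => j _; rewrite eq_sym (negbTE ik) mulr0 !mul0r.
- by rewrite mulr_suml; apply: eq_bigr => i _; rewrite eqxx mulr1 -mulrA mulrC.
Qed.

End ConformalConnection.

(** * Space forms in conformal coordinates and their curvature *)

Section ConformallyFlatMetric.
Context {R : realType} {n : nat}.
Implicit Types (u v w y : 'cV[R]_n).

(** For [gam > 0] this metric has constant curvature [4 * k / gam]: it is flat
    for [k = 0], and the round one for [k = 1], [gam = 4]. *)
Definition space_form_metric (gam k : R) y : 'M[R]_n :=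
  (gam / (1 + k * dot y y) ^+ 2)%:M.

(** Gradient of the logarithm of the conformal factor. *)
Definition space_form_grad (k : R) y : 'cV[R]_n :=
  (- 2 * k / (1 + k * dot y y)) *: y.

Context (gam k : R) (gam0 : gam != 0) (k0 : 0 <= k).

Local Notation sig y := (1 + k * dot y y).
Local Notation grad := (space_form_grad k).
Local Notation h := (space_form_metric gam k).

Lemma space_form_neq0 y : sig y != 0.
Proof. by rewrite lt0r_neq0// ltr_wpDr// mulr_ge0// dot_ge0. Qed.

Lemma is_derive_space_form (phi : 'cV[R]_n -> 'cV[R]_n) x z dphi :
  is_derive x z phi dphi ->
  is_derive x z (fun t => sig (phi t)) (2 * k * dot (phi x) dphi).
Proof.
move=> phiE; apply: is_derive_eq.
  apply: is_deriveD; apply: is_derive_mul; exact: is_derive_dot.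
by rewrite (dotC dphi) /=; ring.
Qed.

Lemma is_derive_space_form_grad y u :
  is_derive y u grad
    ((- 2 * k / sig y) *: u + dot (grad y) u *: grad y).
Proof.
have s0 := space_form_neq0 y.
apply: is_derive_eq.
  apply: is_derive_scale; apply: is_derive_mul.
  apply: is_derive_inv => //; apply: is_derive_space_form; exact: is_derive_id.
apply/matrixP => i j; rewrite /space_form_grad !(mxE, dotE) /=.
by field.
Qed.

Lemma christoffel_form_space_form y u v :
  christoffel_form h y u v = conf (grad y) u v.
Proof.
have s0 := space_form_neq0 y.
apply: (christoffel_form_conformal _ (fun y => gam * ((sig y) ^+ 2)^-1)) => //.
  by rewrite mulf_neq0 ?invr_eq0 ?expf_neq0.
move=> z; apply: is_derive_eq.
  apply: is_derive_mul; apply: is_derive_inv; first by rewrite expf_neq0.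
  apply: is_derive_mul; apply: is_derive_space_form; exact: is_derive_id.
by rewrite /space_form_grad !dotE /=; field.
Qed.

(** Constant fields have zero bracket, and [nabla2] expresses both iterated derivatives through
    [conf], which leaves an algebraic identity. The scalar is the sectional curvature [4 * k / gam]
    times the metric coefficient [gam / sig y ^+ 2]. *)
Lemma curvature_at_space_form y u v w :
  curvature_at h y u v w =
  (4 * k / sig y ^+ 2) *: (dot v w *: u - dot u w *: v).
Proof.
have s0 := space_form_neq0 y.
have nablaE X Z z : nabla h X Z z = 'D_(X z) Z z + conf (grad z) (X z) (Z z).
  by rewrite /nabla christoffel_form_space_form.
have nabla_cst X w' z : nabla h X (cst w') z = conf (grad z) (X z) w'.
  by rewrite nablaE derive_cst add0r.
have nabla2 u' v' : nabla h (cst u') (nabla h (cst v') (cst w)) y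
    = conf ((- 2 * k / sig y) *: u' + dot (grad y) u' *: grad y) v' w
      + conf (grad y) u' (conf (grad y) v' w).
  rewrite nablaE nabla_cst /=.
  rewrite (_ : nabla h (cst v') (cst w) = fun z => conf (grad z) v' w); last first.
    by apply/funext => z; rewrite nabla_cst.
  have := is_derive_conf _ _ _ _ _ _ _ _ (is_derive_space_form_grad y u')
    (is_derive_cst v' y u') (is_derive_cst w y u').
  by move=> ?; rewrite derive_val /= conf0l /conf !dot0r !scale0r scaler0 !(addr0, subr0).
rewrite /curvature_at /curvature !nabla2 nablaE /lie_bracket !derive_cst subr0.
rewrite add0r conf0l subr0.
apply/matrixP => i j; rewrite /conf !(mxE, dotE).
rewrite (dotC u y) (dotC v y) (dotC v u).
by field.
Qed.

End ConformallyFlatMetric.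

(** * Traces and second derivatives over a Euclidean domain *)

Section DomainMetric.
Context {R : realType} {m n : nat} (h : 'cV[R]_n -> 'M[R]_n).
Context (phi : 'cV[R]_m -> 'cV[R]_n).

Lemma trace_g_euclidean x (B : 'I_m -> 'I_m -> 'cV[R]_n) :
  trace_g euclidean_metric x B = \sum_i B i i.
Proof.
apply: eq_bigr => i _; rewrite (bigD1 i)//= big1 ?addr0 => [|j ji].
  by rewrite invmx1 mxE eqxx scale1r.
by rewrite invmx1 mxE eq_sym (negbTE ji) scale0r.
Qed.

Lemma nabla_frame_euclidean i j x : nabla_frame euclidean_metric i j x = 0 :> 'cV[R]_m.
Proof.
rewrite /nabla_frame /nabla derive_cst add0r.
(* The Euclidean metric has constant conformal factor 1, hence zero logarithmic gradient; [0] is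
   written as a [conf] term to match the general formula. *)
rewrite -[RHS](conf0 (frame i) (frame j)).
apply: (christoffel_form_conformal _ (cst 1)) => // [|z]; first exact: oner_neq0.
by rewrite dot0l mulr0; exact: is_derive_cst.
Qed.

Lemma second_fundamental_form_euclidean i j x :
  second_fundamental_form euclidean_metric h phi i j x =
  nabla_pull h phi (frame i) (dmap phi (frame j)) x.
Proof.
by rewrite /second_fundamental_form nabla_frame_euclidean /dmap derive0 subr0.
Qed.

Lemma nabla2_pull_euclidean V i j x :
  nabla2_pull euclidean_metric h phi V i j x =
  nabla_pull h phi (frame i) (nabla_pull h phi (frame j) V) x.
Proof.
rewrite /nabla2_pull nabla_frame_euclidean [X in _ - X]/nabla_pull /dmap !derive0 add0r.
rewrite (_ : christoffel_form _ _ _ _ = 0) ?subr0//.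
apply/matrixP => l l'; rewrite !mxE big1// => i' _; rewrite big1// => j' _.
by rewrite mxE mulr0 mul0r.
Qed.

End DomainMetric.

(** Identities known only on the open set [U] can be differentiated there, since derivatives depend
    only on germs. *)
Lemma near_open_eq {R : realType} {m : nat} {T : Type} (U : set 'cV[R]_m)
    (f g : 'cV[R]_m -> T) x :
  open U -> U x -> (forall z, U z -> f z = g z) -> \near x, f x = g x.
Proof.
move=> oU Ux fg; have : nbhs x U by exact: open_nbhs_nbhs.
by apply: filterS.
Qed.

(** * The connection term in matrix form, for use with the product rule *)

Section ConformalMatrix.
Context {R : realType} {n : nat}.
Implicit Types (q u v : 'cV[R]_n).

Definition conf_mx q u : 'M[R]_n := (dot q u)%:M + u *m q^T - q *m u^T.

Lemma conf_mxE q u v : conf q u v = conf_mx q u *m v.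
Proof.
rewrite /conf_mx mulmxBl mulmxDl -!mulmxA !dot_mulmx !mul_mx_scalar.
by rewrite mul_scalar_mx.
Qed.

Lemma is_derive_cols {d m} (J : 'cV[R]_d -> 'M[R]_(m, n)) (x u : 'cV[R]_d)
    (M : 'M[R]_(m, n)) :
  (forall v, is_derive x u (fun z => J z *m v) (M *m v)) -> is_derive x u J M.
Proof.
have colE (N : 'M[R]_(m, n)) i j : (N *m frame j) i 0 = N i j.
  by rewrite -colE mxE.
move=> JE; apply: is_derive_mx => i j.
have := is_derive_entry _ _ _ _ i 0 (JE (frame j)).
by rewrite colE; under eq_fun do rewrite colE.
Qed.

End ConformalMatrix.

(** * Tension and bitension of a conformal map into a space form *)

Section ConformalMap.
Context {R : realType} (gam k : R) (gam0 : gam != 0) (k0 : 0 <= k).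
Context (U : set 'cV[R]_4) (openU : open U).
Context (phi : 'cV[R]_4 -> 'cV[R]_4) (J : 'cV[R]_4 -> 'M[R]_4).
Context (lam : 'cV[R]_4 -> R) (p0 : 'cV[R]_4 -> 'cV[R]_4).
Context (Q : 'cV[R]_4 -> R) (dQ : 'cV[R]_4 -> 'cV[R]_4) (c alpha : R).

Local Notation sig y := (1 + k * dot y y).
Local Notation h := (space_form_metric gam k).
Local Notation p := (fun x => - (Q x)^-1 *: dQ x).

(** [J] is the Jacobian of [phi], and [JJ] says that [phi] is conformal. In [JE], [p0] plays the
    role of half the gradient of [ln lam]. By [lamE] the pulled-back metric is
    [gam * alpha ^+ 2 / Q ^+ 2] times the flat one, and [pE] is the matching chain rule for
    logarithmic gradients. *)
Hypothesis phiE : forall x v, U x -> is_derive x v phi (J x *m v).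
Hypothesis JE : forall x u v, U x ->
  is_derive x u (fun z => J z *m v) (J x *m conf (p0 x) u v).
Hypothesis JJ : forall x, U x -> (J x)^T *m J x = (lam x)%:M.
Hypothesis lam0 : forall x, U x -> lam x != 0.
Hypothesis Q0 : forall x, U x -> Q x != 0.
Hypothesis QE : forall x v, U x -> is_derive x v Q (dot (dQ x) v).
Hypothesis dQE : forall x v, U x -> is_derive x v dQ (2 * c *: v).
Hypothesis dot_dQ : forall x, U x ->
  dot (dQ x) (dQ x) = 4 * c * Q x - 4 * k * alpha ^+ 2.
Hypothesis pE : forall x, U x ->
  p x = p0 x + (J x)^T *m space_form_grad k (phi x).
Hypothesis lamE : forall x, U x ->
  lam x / sig (phi x) ^+ 2 = alpha ^+ 2 / Q x ^+ 2.

Lemma dot_Jacobian x u v : U x -> dot (J x *m u) (J x *m v) = lam x * dot u v.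
Proof. by move=> Ux; rewrite dot_adj mulmxA JJ// mul_scalar_mx dotZr. Qed.

(** A left inverse of a square matrix is also a right inverse. This lets target vectors scaled by
    [lam x] be written as images under [J x]. *)
Lemma JJtr x : U x -> J x *m (J x)^T = (lam x)%:M.
Proof.
move=> Ux; have l0 := lam0 _ Ux.
have JVJ : ((lam x)^-1 *: (J x)^T) *m J x = 1%:M.
  by rewrite -scalemxAl JJ// scale_scalar_mx mulVf.
have := mulmx1C JVJ; rewrite -scalemxAr => /(congr1 ( *:%R (lam x))).
by rewrite scalerA mulfV// scale1r scale_scalar_mx mulr1.
Qed.

(** The pull-back connection corresponds under [J] to the Levi-Civita
    connection of the conformally flat metric [phi^* h], whose conformal factor
    is, up to a constant, [Q ^ -2]. *)
Lemma nabla_pull_Jacobian V w x u dw : U x ->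
  (forall z, U z -> V z = J z *m w z) -> is_derive x u w dw ->
  nabla_pull h phi u V x = J x *m (dw + conf (p x) u (w x)).
Proof.
move=> Ux VE wE; have dphi := phiE x u Ux.
rewrite /nabla_pull (christoffel_form_space_form _ _ gam0 k0) /dmap.
rewrite [X in conf _ X]derive_val VE//.
rewrite (near_eq_derive _ (near_open_eq _ _ _ _ openU Ux VE)).
have Jder : is_derive x u J (J x *m conf_mx (p0 x) u).
  by apply: is_derive_cols => v; rewrite -mulmxA -conf_mxE; exact: JE.
have ? := is_derive_mulmx _ _ _ _ _ _ Jder wE.
rewrite derive_val -[J x *m _ *m _]mulmxA -conf_mxE pE//.
move: (space_form_grad k (phi x)) => q.
rewrite /conf dot_Jacobian// !dotDl !(dotC ((J x)^T *m q)) -!dot_adj.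
rewrite !(dotC _ q) !mulmxDr !mulmxN -!scalemxAr mulmxDr mulmxA JJtr//.
rewrite mul_scalar_mx.
move: (J x *m u) (J x *m w x) (J x *m p0 x) (J x *m dw) => Ju Jw Jp Jdw.
by apply/matrixP => i j; rewrite !mxE; ring.
Qed.

Local Notation tau := (tension euclidean_metric h phi).

(** The Hessian of [Q] is [2 * c] times the identity; the quadratic term in [p] comes from
    differentiating the inverse of [Q]. *)
Lemma is_derive_p x u : U x ->
  is_derive x u p (- (2 * c / Q x) *: u + dot (p x) u *: p x).
Proof.
move=> Ux; have q0 := Q0 _ Ux; apply: is_derive_eq.
  apply: is_derive_scale; last exact: dQE.
  apply: is_deriveN; apply: is_derive_inv => //; exact: QE.
by apply/matrixP => i j; rewrite !(mxE, dotE); field.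
Qed.

(** Under [J], [dmap phi (frame i)] is the constant field [frame i], so only the connection term
    [2 <p, e_i> e_i - p] survives. Its sum over the frame is [(2 - 4) p]. *)
Lemma tension_Jacobian x : U x -> tau x = J x *m (- 2 *: p x).
Proof.
move=> Ux; rewrite /tension trace_g_euclidean.
under eq_bigr => i _.
  rewrite second_fundamental_form_euclidean.
  rewrite (nabla_pull_Jacobian _ (cst (frame i)) _ _ 0) //; last first.
    by move=> z Uz; rewrite /dmap (@derive_val _ _ _ _ _ _ _ (phiE z _ Uz)).
  rewrite add0r /conf dot_frameii scale1r -mulr2n -scaler_nat.
  over.
rewrite -mulmx_sumr sumrB -scaler_sumr sum_dot_frame sumr_const card_ord.
by rewrite -(scaler_nat 4) -scalerBl; congr (_ *m (_ *: _)); ring.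
Qed.

(** [4 * K x] is the sectional curvature [4 * k / gam] times the conformal factor of the pulled-back
    metric. *)
Local Notation K x := (k * alpha ^+ 2 / Q x ^+ 2).

Lemma dot_p x : U x -> dot (p x) (p x) = 4 * c / Q x - 4 * K x.
Proof.
by move=> Ux; have q0 := Q0 _ Ux; rewrite !dotE dot_dQ//; field.
Qed.

(** The covariant derivative of [-2 *: p] along [u]; the scalar [2 * c / Q x - 4 * K x] is
    [<p, p> - 2 * c / Q x], rewritten by [dot_p]. *)
Local Notation nabla_w u x :=
  (- 2 *: (dot (p x) u *: p x + (2 * c / Q x - 4 * K x) *: u)).

Lemma nabla_pull_tension x u : U x ->
  nabla_pull h phi u tau x = J x *m nabla_w u x.
Proof.
move=> Ux; have wE := is_deriveZ (- 2 : R) (is_derive_p x u Ux).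
rewrite (nabla_pull_Jacobian _ _ _ _ _ Ux tension_Jacobian wE).
rewrite /conf dotZr dot_p// dotZr (dotC u).
move: (p x) => P.
by congr (_ *m _); apply/matrixP => i j; rewrite !mxE; field; exact: Q0.
Qed.

(** Since [1 / Q] has logarithmic gradient [p], the terms [2 * c / Q] and [K] are multiplied by
    [<p, u>] and [2 <p, u>] when differentiated. In the coefficient of [u] the contributions of
    [c / Q] cancel. *)
Lemma is_derive_nabla_w x u : U x ->
  is_derive x u (fun z => nabla_w u z)
    (- 2 *: ((dot (p x) u ^+ 2 - 2 * c / Q x * dot u u) *: p x
      + (dot (p x) u * (dot (p x) u)) *: p x
      + ((- 8 * K x) * dot (p x) u) *: u)).
Proof.
move=> Ux; have q0 := Q0 _ Ux; have pder := is_derive_p x u Ux.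
have uder := is_derive_cst u x u.
have Qder : is_derive x u (fun z => 2 * c / Q z - 4 * K z)
    ((2 * c / Q x - 8 * K x) * dot (p x) u).
  apply: is_derive_eq.
    apply: is_deriveB.
      by apply: is_derive_mul; apply: is_derive_inv q0 (QE _ _ Ux).
    apply: is_derive_mul; apply: is_derive_mul; apply: is_derive_inv.
      by rewrite expf_neq0.
    by apply: is_derive_mul; exact: QE.
  by rewrite !dotE /=; field.
apply: is_derive_eq.
  apply: is_deriveZ; apply: is_deriveD.
    have pu := is_derive_dot _ _ _ _ _ _ pder uder.
    exact: is_derive_scale pu pder.
  exact: is_derive_scale Qder uder.
rewrite !(dotDl, dotZl) /= dot0r scaler0 !addr0.
move: (dQ x) => P.
by apply/matrixP => i j; rewrite !mxE; field.
Qed.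

Lemma nabla2_pull_tension x u : U x -> dot u u = 1 ->
  nabla_pull h phi u (nabla_pull h phi u tau) x =
  J x *m (- 2 *: ((4 * K x - 4 * c / Q x) *: p x
    + (2 * dot (p x) u ^+ 2) *: p x
    + ((8 * c / Q x - 20 * K x) * dot (p x) u) *: u)).
Proof.
move=> Ux uu; have q0 := Q0 _ Ux.
rewrite (nabla_pull_Jacobian _ _ _ _ _ Ux
  (fun z => nabla_pull_tension z u) (is_derive_nabla_w x u Ux)).
have := dot_p x Ux; move: (p x) => P PP; congr (_ *m _).
rewrite /conf !(dotDr, dotZr, dotNr) PP uu (dotC u P).
by apply/matrixP => i j; rewrite !mxE; field.
Qed.

Lemma bitension_conformal x : U x -> bitension euclidean_metric h phi x = 0.
Proof.
move=> Ux; have q0 := Q0 _ Ux; rewrite /bitension !trace_g_euclidean.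
under eq_bigr => i _ do
  rewrite nabla2_pull_euclidean nabla2_pull_tension ?dot_frameii//.
under [X in _ - X]eq_bigr => i _.
  rewrite (curvature_at_space_form _ _ gam0 k0) /dmap.
  rewrite (@derive_val _ _ _ _ _ _ _ (phiE x (frame i) Ux)).
  rewrite tension_Jacobian// !dot_Jacobian// dot_frameii.
  over.
rewrite -mulmx_sumr -!scaler_sumr !big_split/= !sumr_const !card_ord.
have PP := dot_p x Ux; move: (p x) PP => P PP.
have sum_frame a w : \sum_i (a * dot w (frame i)) *: frame i = a *: w :> 'cV[R]_4.
  by under eq_bigr do rewrite -scalerA; rewrite -scaler_sumr sum_dot_frame.
rewrite -scaler_suml -mulr_sumr sum_dot_frame_sqr PP sum_frame sumrN.
under [X in _ - _ *: (_ - X)]eq_bigr do rewrite scalemxAr.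
rewrite -mulmx_sumr sum_frame.
(* The target curvature, transported to the domain by [lamE]. *)
have KE : 4 * k / sig (phi x) ^+ 2 * lam x = 4 * K x.
  by have := lamE x Ux; rewrite -!mulrA [_^-1 * lam x]mulrC => ->; rewrite !mulrA.
move: KE; set t := 4 * k / _ => tlam.
rewrite -[(_ *: P) *+ 4]scaler_nat -!scalemxAr !mulmxDr -!scalemxAr.
move: (J x *m P) => JP.
(* The first group is the trace of the rough Laplacian, with [<p, p>] replaced by [dot_p]: the terms
   in [c] cancel and [-24 K] remains. The curvature trace gives [6 = 2 * (4 - 1)] times [t * lam x],
   that is [24 K]. *)
transitivity ((2 * (4 * (4 * K x - 4 * c / Q x) + 2 * (4 * c / Q x - 4 * K x)
    + (8 * c / Q x - 20 * K x)) + 6 * (t * lam x)) *: JP).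
  by apply/matrixP => i j; rewrite !mxE; ring.
by rewrite tlam -[RHS](scale0r JP); congr (_ *: _); ring.
Qed.

(** The Jacobian scales squared lengths by [lam x], which is nonzero, so it is injective; and [p x]
    is a nonzero multiple of [dQ x]. *)
Lemma tension_bitension_conformal x : U x ->
  bitension euclidean_metric h phi x = 0 /\ (tau x = 0 <-> dQ x = 0).
Proof.
move=> Ux; split; first exact: bitension_conformal.
rewrite tension_Jacobian//; split=> [tau0|->]; last by rewrite !scaler0 mulmx0.
have := dot_Jacobian x (- 2 *: p x) (- 2 *: p x) Ux.
move/eqP; rewrite tau0 dot0l eq_sym mulf_eq0 (negbTE (lam0 _ Ux)) dot_eq0.
by rewrite !scaler_eq0 !oppr_eq0 invr_eq0 (negbTE (Q0 _ Ux)) pnatr_eq0 => /eqP.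
Qed.

End ConformalMap.

Lemma trmx_scale {R : realType} {m n : nat} (c : R) (M : 'M[R]_(m, n)) :
  (c *: M)^T = c *: M^T.
Proof. exact: linearZ. Qed.

Lemma mulmx_inj {R : realType} {m n : nat} (M N : 'M[R]_(m, n)) :
  (forall v : 'cV[R]_n, M *m v = N *m v) -> M = N.
Proof.
move=> MN; apply/matrixP => i j.
by have /matrixP/(_ i 0) := MN (frame j); rewrite -!colE !mxE.
Qed.

Lemma is_derive_mulmxr {R : realType} {d m n : nat} (A : 'M[R]_(m, n))
    (F : 'cV[R]_d -> 'cV[R]_n) x v dF :
  is_derive x v F dF -> is_derive x v (fun z => A *m F z) (A *m dF).
Proof.
move=> FE; have := is_derive_mulmx _ _ _ _ _ _ (is_derive_cst A x v) FE.
by rewrite mul0mx add0r.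
Qed.

(** * Similarities and inversions as instances of the conformal computation *)

Section Mobius.
Context {R : realType} {a b : 'cV[R]_4} {alpha : R} {A : 'M[R]_4}.
Context (alpha0 : alpha != 0) (AA : A^T *m A = 1%:M).
Context (gam k : R) (gam0 : gam != 0) (k0 : 0 <= k).

Local Notation sig y := (1 + k * dot y y).
Local Notation h := (space_form_metric gam k).
Local Notation s x := (dot (x - b) (x - b)).

(** [sig o phi], cleared of its denominator, is one of these quadratics. *)
Local Notation quad c e :=
  (fun x => c * s x + 2 * k * alpha * dot a (A *m (x - b)) + e).
Local Notation dquad c :=
  (fun x => (2 * c) *: (x - b) + (2 * k * alpha) *: (A^T *m a)).

Lemma dotAA u v : dot (A *m u) (A *m v) = dot u v.
Proof. by rewrite dot_adj mulmxA AA mul1mx. Qed.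

Lemma is_derive_center x v : is_derive x v (fun z => z - b) v.
Proof. by apply: is_derive_eq; rewrite subr0. Qed.

Lemma is_derive_quad c e x v :
  is_derive x v (quad c e) (dot (dquad c x) v).
Proof.
have cE := is_derive_center x v.
apply: is_derive_eq.
  apply: is_deriveD; apply: is_deriveD; apply: is_derive_mul.
    exact: (is_derive_dot _ _ _ _ _ _ cE cE).
  by apply: is_derive_dot; apply: is_derive_mulmxr.
rewrite /=; move: (x - b) => y.
by rewrite !dotE dot_adj trmxK dot0l (dotC v); ring.
Qed.

Lemma is_derive_dquad c x v : is_derive x v (dquad c) (2 * c *: v).
Proof.
have cE := is_derive_center x v.
have cstE := is_derive_cst ((2 * k * alpha) *: (A^T *m a)) x v.
by have := is_deriveD (is_deriveZ (2 * c) cE) cstE; rewrite addr0.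
Qed.

(** After expansion only the constant terms have to be compared: the hypothesis makes
    [4 c e - 4 k alpha^2] equal to [4 k^2 alpha^2 |a|^2]. *)
Lemma dot_dquad c e x : c * e = k * alpha ^+ 2 * sig a ->
  dot (dquad c x) (dquad c x) = 4 * c * quad c e x - 4 * k * alpha ^+ 2.
Proof.
move=> ce; have -> : 4 * c * quad c e x = 4 * (c ^+ 2 * s x +
  2 * k * alpha * c * dot a (A *m (x - b)) + c * e) by ring.
rewrite ce; move: (x - b) => y; rewrite !dotE (dotC y) !dot_adj trmxK.
by rewrite mulmxA (mulmx1C AA) mul1mx; ring.
Qed.

Lemma mobius_similarity x :
  bitension euclidean_metric h (mobius a b alpha A 0) x = 0 /\
  (tension euclidean_metric h (mobius a b alpha A 0) x = 0 <->
   dquad (k * alpha ^+ 2) x = 0).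
Proof.
have phi_eq z : mobius a b alpha A 0 z = a + alpha *: (A *m (z - b)).
  by rewrite /mobius expr0 invr1 scale1r.
(* For a similarity there is no denominator to clear: [Q] is [sig o phi] itself. The Jacobian is
   constant, so [p0] is zero below. *)
have QE z : sig (mobius a b alpha A 0 z) = quad (k * alpha ^+ 2) (sig a) z.
  rewrite phi_eq; move: (z - b) => y.
  by rewrite !(dotDl, dotDr, dotZl, dotZr) dotAA (dotC (A *m y)); ring.
apply: (tension_bitension_conformal _ _ gam0 k0 setT openT _ (cst (alpha *: A))
  (cst (alpha ^+ 2)) (cst 0) (quad (k * alpha ^+ 2) (sig a))
  (dquad (k * alpha ^+ 2)) (k * alpha ^+ 2) alpha) => //.
- move=> z v _; rewrite (funext phi_eq).
  have phiE := is_deriveZ alpha (is_derive_mulmxr A _ _ _ _ (is_derive_center z v)).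
  by have := is_deriveD (is_derive_cst a z v) phiE; rewrite add0r scalemxAl.
- by move=> z u v _; rewrite conf0 mulmx0; exact: (is_derive_cst (alpha *: A *m v)).
- move=> z _; rewrite /= trmx_scale -scalemxAl -scalemxAr AA.
  by rewrite scalerA scale_scalar_mx mulr1 expr2.
- by move=> z _; rewrite expf_neq0.
- by move=> z _; rewrite -QE space_form_neq0.
- by move=> z v _; exact: is_derive_quad.
- by move=> z v _; exact: is_derive_dquad.
- by move=> z _; apply: dot_dquad; ring.
- move=> z _; rewrite -QE add0r /space_form_grad phi_eq.
  move: (space_form_neq0 _ k0 (a + alpha *: (A *m (z - b)))); move: (sig _) => r r0.
  rewrite trmx_scale -scalemxAl -scalemxAr mulmxDr -scalemxAr mulmxA AA mul1mx.
  move: (z - b) (A^T *m a) => y t.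
  by apply/matrixP => i j; rewrite !mxE; field.
- by move=> z _; rewrite QE.
Qed.

Lemma mobius_inversion x : x != b ->
  bitension euclidean_metric h (mobius a b alpha A 2) x = 0 /\
  (tension euclidean_metric h (mobius a b alpha A 2) x = 0 <->
   dquad (sig a) x = 0).
Proof.
have phi_eq z : mobius a b alpha A 2 z = a + (s z)^-1 *: (alpha *: (A *m (z - b))).
  by rewrite /mobius enorm_sqr.
have s0 z : z != b -> s z != 0 by rewrite dot_eq0 subr_eq0.
(* Multiplying [sig o phi] by [s] clears the denominator. Compared with a similarity, the leading
   and constant coefficients are exchanged. *)
pose Q := quad (sig a) (k * alpha ^+ 2).
have QE z : z != b -> Q z = s z * sig (mobius a b alpha A 2 z).
  move=> /s0; rewrite phi_eq /Q; move: (z - b) => y y0.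
  rewrite !(dotDl, dotDr, dotZl, dotZr) dotAA (dotC (A *m y)).
  by field.
have Q0 z : z != b -> Q z != 0.
  by move=> zb; rewrite QE// mulf_neq0 ?s0// space_form_neq0.
(* For [z != b], the reflection in the hyperplane orthogonal to [z - b]; the derivative of
   [y / |y|^2] is this reflection divided by [s z]. *)
pose B z : 'M[R]_4 := 1%:M - (2 / s z) *: ((z - b) *m (z - b)^T).
have BE z v : B z *m v = v - (2 / s z * dot (z - b) v) *: (z - b).
  rewrite /B mulmxBl mul1mx -scalemxAl -mulmxA dot_mulmx mul_mx_scalar.
  by rewrite scalerA.
have Btr z : (B z)^T = B z.
  by rewrite /B linearB/= trmx_scale trmx_mul trmxK trmx1.
pose J z := (alpha / s z) *: (A *m B z).
have JtrE z v : (J z)^T *m v = (alpha / s z) *: (B z *m (A^T *m v)).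
  by rewrite /J trmx_scale trmx_mul Btr -scalemxAl mulmxA.
have JE z v : J z *m v = (alpha / s z) *: (A *m (B z *m v)).
  by rewrite /J -scalemxAl mulmxA.
have sE z v : is_derive z v (fun z => s z) (2 * dot (z - b) v).
  have cE := is_derive_center z v.
  apply: is_derive_eq; first exact: (is_derive_dot _ _ _ _ _ _ cE cE).
  by rewrite (dotC v) mulr_natl mulr2n.
have sVE z v : z != b -> is_derive z v (fun z => (s z)^-1)
    (- (2 * dot (z - b) v) / s z ^+ 2).
  by move=> /s0 z0; apply: (is_derive_inv (fun z => s z)).
move/eqP => xb.
(* Reflections and [A] are isometries, so [lam] is [(alpha / s) ^+ 2]; [p0] is the gradient of
   [- ln s]. *)
apply: (tension_bitension_conformal _ _ gam0 k0 (~` [set b]) _ _ J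
  (fun z => (alpha / s z) ^+ 2) (fun z => (- 2 / s z) *: (z - b)) Q
  (dquad (sig a)) (sig a) alpha) => //.
- by apply: closed_openC; exact/accessible_closed_set1/hausdorff_accessible/norm_hausdorff.
- move=> z v /eqP zb; rewrite (funext phi_eq) JE BE.
  have cE := is_derive_center z v.
  have AE := is_deriveZ alpha (is_derive_mulmxr A _ _ _ _ cE).
  have := is_deriveD (is_derive_cst a z v) (is_derive_scale _ _ _ _ _ _ (sVE z v zb) AE).
  rewrite add0r; move/is_derive_eq; apply.
  have := s0 z zb; rewrite /=; move: (z - b) => y y0.
  rewrite !scalemxAr -mulmxDr; congr (_ *m _).
  by apply/matrixP => i j; rewrite !mxE; field.
- move=> z u v /eqP zb; under eq_fun do rewrite JE BE scalemxAr.
  rewrite JE BE scalemxAr; apply: is_derive_mulmxr.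
  have cE := is_derive_center z u.
  have vE := is_derive_cst v z u.
  have divE r := is_derive_mul _ _ _ _ _ _ (is_derive_cst (r : R) z u) (sVE z u zb).
  have yvE := is_derive_dot _ _ _ _ _ _ cE vE.
  have projE := is_derive_scale _ _ _ _ _ _
    (is_derive_mul _ _ _ _ _ _ (divE 2) yvE) cE.
  have reflE : is_derive z u
    (fun t => v - (2 / s t * dot (t - b) v) *: (t - b)) _ := is_deriveB vE projE.
  apply: is_derive_eq.
    exact: (is_derive_scale _ _ _ _ _ _ (divE alpha) reflE).
  have := s0 z zb; rewrite /conf /=; move: (z - b) => y y0.
  apply/matrixP => i j; rewrite !(mxE, dotE) dot0r.
  by field.
- move=> z /eqP zb; apply: mulmx_inj => v.
  rewrite -mulmxA JtrE JE -!scalemxAr [A^T *m _]mulmxA AA mul1mx mul_scalar_mx.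
  rewrite !BE; have := s0 z zb; move: (z - b) => y y0.
  by apply/matrixP => i j; rewrite !(mxE, dotE); field.
- by move=> z /eqP /s0 z0; rewrite expf_neq0// mulf_neq0// invr_eq0.
- by move=> z /eqP; exact: Q0.
- by move=> z v _; exact: is_derive_quad.
- by move=> z v _; exact: is_derive_dquad.
- by move=> z _; apply: dot_dquad; ring.
- move=> z /eqP zb; rewrite JtrE /space_form_grad.
  have z0 := s0 z zb; have Qz := Q0 z zb.
  have -> : sig (mobius a b alpha A 2 z) = Q z / s z by rewrite QE// mulrAC divff// mul1r.
  rewrite -scalemxAr phi_eq mulmxDr -!scalemxAr mulmxA AA mul1mx.
  rewrite BE.
  have QQ : Q z = sig a * s z + 2 * k * alpha * dot (z - b) (A^T *m a) + k * alpha ^+ 2.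
    by rewrite (dotC (z - b)) dot_adj trmxK.
  rewrite QQ; move: Qz; rewrite QQ.
  move: (z - b) z0 (A^T *m a) => y y0 t q0.
  by apply/matrixP => i j; rewrite !(mxE, dotE); field; rewrite y0.
- move=> z /eqP zb; have := Q0 z zb; rewrite QE// mulf_eq0 negb_or => /andP[z0 q0].
  by field; rewrite q0 z0.
Qed.

End Mobius.

(** * Smoothness of rational maps without poles on an open set *)

Section RationalFunctions.
Context {R : realType} {d : nat} (U : set 'cV[R]_d) (openU : open U).

(** An inductive class makes closure under differentiation a structural induction; denominators must
    be nonzero on [U] only. *)
Inductive rational_on : ('cV[R]_d -> R) -> Prop :=
| rational_cst c : rational_on (fun=> c)
| rational_coord i : rational_on (fun z => z i 0)
| rational_add f g :
    rational_on f -> rational_on g -> rational_on (fun z => f z + g z)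
| rational_mul f g :
    rational_on f -> rational_on g -> rational_on (fun z => f z * g z)
| rational_inv f : rational_on f -> (forall z, U z -> f z != 0) ->
    rational_on (fun z => (f z)^-1).

Lemma rational_sum n (F : 'I_n -> 'cV[R]_d -> R) :
  (forall i, rational_on (F i)) -> rational_on (fun z => \sum_(i < n) F i z).
Proof.
elim: n F => [|n IHn] F FE.
  by under eq_fun do rewrite big_ord0; exact: rational_cst.
under eq_fun do rewrite big_ord_recr.
by apply: rational_add; first exact: IHn.
Qed.

Lemma rational_differentiable f x : rational_on f -> U x -> differentiable f x.
Proof.
move=> fE Ux; elim: fE => {f} [c|i|f g _ df _ dg|f g _ df _ dg|f _ df f0].
- exact: differentiable_cst.
- exact: differentiable_coord.
- exact: differentiableD.
- exact: differentiableM.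
- by apply: differentiableV; last exact: f0.
Qed.

Lemma rational_derive f v : rational_on f ->
  exists g, rational_on g /\ forall x, U x -> is_derive x v f (g x).
Proof.
elim=> {f} [c|i|f g rf [f' [rf' fE]] rg [g' [rg' gE]]
  |f g rf [f' [rf' fE]] rg [g' [rg' gE]]|f rf [f' [rf' fE]] f0].
- exists (fun=> 0); split; first exact: rational_cst.
  by move=> x _; exact: is_derive_cst.
- exists (fun=> v i 0); split; first exact: rational_cst.
  by move=> x _; apply: is_derive_entry; exact: is_derive_id.
- exists (fun z => f' z + g' z); split; first exact: rational_add.
  by move=> x Ux; apply: is_deriveD; [exact: fE|exact: gE].
- exists (fun z => f' z * g z + f z * g' z); split.
    by apply: rational_add; exact: rational_mul.
  by move=> x Ux; apply: is_derive_mul; [exact: fE|exact: gE].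
- exists (fun z => (-1 * f' z) * ((f z)^-1 * (f z)^-1)); split.
    do !apply: rational_mul => //; first exact: rational_cst.
      exact: rational_inv.
    exact: rational_inv.
  move=> x Ux; rewrite mulN1r -invfM -expr2.
  by apply: is_derive_inv; [exact: f0|exact: fE].
Qed.

(** The first-order expansion at [x] depends only on the germ, so the differential of [f] also
    serves for [g]. *)
Lemma near_eq_differentiable {V W : normedModType R} (f g : V -> W) x :
  (\near x, f x = g x) -> differentiable f x -> differentiable g x.
Proof.
move=> fg df.
have gE : g \o shift x = cst (g x) + 'd f x +o_ 0 id.
  apply/eqaddoP => e e0.
  have fgx : f x = g x by exact: nbhs_singleton fg.
  have fg0 : \forall y \near (0 : V), f (y + x) = g (y + x).
    by move: fg; rewrite (near_shift 0)/=; apply: filterS => z; rewrite /= subr0.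
  have := (eqaddoP _ _ _ _).1 (diff_locally df) e e0.
  apply: filter_app; near=> y; rewrite !fctE /= -fgx.
  by rewrite (near fg0 y).
have dgE : 'd g x = 'd f x :> (V -> W).
  by apply: diff_unique gE; exact: diff_continuous.
by apply/diff_locallyP; rewrite dgE; split => //; exact: diff_continuous.
Unshelve. all: by end_near. Qed.

Lemma differentiable_mx {n} (F : 'cV[R]_d -> 'cV[R]_n) x :
  (forall i, differentiable (fun z => F z i 0) x) -> differentiable F x.
Proof.
move=> FE; have -> : F = \sum_(i < n) (fun z => F z i 0 *: frame i).
  apply/funext => z; rewrite fct_sumE -[LHS]sum_dot_frame.
  by apply: eq_bigr => i _; rewrite dot_frame.
by apply: differentiable_sum => i; exact: differentiableZl.
Qed.

Lemma rational_smooth_on {n} (F : 'cV[R]_d -> 'cV[R]_n) :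
  (forall i, rational_on (fun z => F z i 0)) -> smooth_on U F.
Proof.
move=> FE s x Ux.
(* Iterated partials agree with a rational map on [U] only, and may differ at the poles; induction
   carries such a representative [G]. *)
have [G [GE sG]] : exists G : 'cV[R]_d -> 'cV[R]_n,
    (forall i, rational_on (fun z => G z i 0)) /\
    forall z, U z -> G z = iter_partial s F z.
  elim: s => [|i s [G [GE sG]]]; first by exists F.
  have [g gE] := choice (fun j => rational_derive _ (frame i) (GE j)).
  exists (fun z => \col_j g j z); split=> [j|z Uz].
    by under eq_fun do rewrite mxE; exact: (gE j).1.
  rewrite /= -(near_eq_derive _ (near_open_eq _ _ _ _ openU Uz sG)).
  have : is_derive z (frame i) G (\col_j g j z).
    by apply: is_derive_mx => j j'; rewrite ord1 mxE; exact: (gE j).2.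
  by move=> ?; rewrite derive_val.
apply: near_eq_differentiable (near_open_eq _ _ _ _ openU Ux sG) _.
by apply: differentiable_mx => i; exact: rational_differentiable.
Qed.

End RationalFunctions.

(** * Biharmonicity and the harmonic case for all space forms at once *)

Section MobiusBiharmonic.
Context {R : realType} {a b : 'cV[R]_4} {alpha : R} {A : 'M[R]_4} {eps : nat}.
Context (alpha0 : alpha != 0) (AA : A^T *m A = 1%:M).
Context (heps : eps = 0%N \/ eps = 2%N).

Local Notation phi := (mobius a b alpha A eps).
Local Notation U := (mobius_domain b eps).

Lemma open_mobius_domain : open U.
Proof.
rewrite /mobius_domain; case: ifP => _; first exact: openT.
by apply: closed_openC; exact/accessible_closed_set1/hausdorff_accessible/norm_hausdorff.
Qed.

Lemma mobius_smooth_on : smooth_on U phi.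
Proof.
apply: rational_smooth_on => [|i]; first exact: open_mobius_domain.
have rat_center j : rational_on U (fun z => (z - b) j 0).
  under eq_fun do rewrite !mxE.
  by apply: rational_add; [exact: rational_coord|exact: rational_cst].
have rat_image : rational_on U (fun z => (alpha *: (A *m (z - b))) i 0).
  under eq_fun do rewrite 2!mxE.
  apply: rational_mul; first exact: rational_cst.
  by apply: rational_sum => j; apply: rational_mul; first exact: rational_cst.
under eq_fun do rewrite /mobius mxE [X in _ + X]mxE.
apply: rational_add; first exact: rational_cst.
(* Both exponents are even, so the power of [enorm] is a polynomial and no square root remains. *)
apply: rational_mul => //; move: rat_center; case: heps => -> rat_center.
  by under eq_fun do rewrite expr0 invr1; exact: rational_cst.
under eq_fun do rewrite enorm_sqr.
apply: rational_inv.
  by apply: rational_sum => j; apply: rational_mul; exact: rat_center.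
by move=> z /eqP zb; rewrite dot_eq0 subr_eq0.
Qed.

(** Harmonicity means that the affine map [dQ] vanishes on the domain, which forces its slope
    [2 * c] to be zero. For [eps = 2] this is impossible because [c] is [1 + k |a|^2], and for
    [eps = 0] it gives [k = 0]. *)
Lemma mobius_biharmonic (gam k : R) : gam != 0 -> 0 <= k ->
  biharmonic euclidean_metric (space_form_metric gam k) phi U /\
  (Defs.harmonic euclidean_metric (space_form_metric gam k) phi U <->
   eps = 0%N /\ k = 0).
Proof.
move=> gam0 k0.
pose c := if eps == 0%N then k * alpha ^+ 2 else 1 + k * dot a a.
pose dQ x := (2 * c) *: (x - b) + (2 * k * alpha) *: (A^T *m a).
have tauE x : U x ->
    bitension euclidean_metric (space_form_metric gam k) phi x = 0 /\
    (tension euclidean_metric (space_form_metric gam k) phi x = 0 <-> dQ x = 0).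
  rewrite /dQ /c; case: heps => -> /= Ux.
    exact: mobius_similarity.
  by apply: mobius_inversion => //; exact/eqP.
split; first by split; [exact: mobius_smooth_on|move=> x /tauE []].
split=> [[_ tau0]|[e0 kE]]; last first.
  split=> [|x Ux]; first exact: mobius_smooth_on.
  apply: (tauE x Ux).2.2.
  by rewrite /dQ /c e0 kE eqxx !(mul0r, mulr0) !scale0r addr0.
(* Points different from the centre lie in the domain for either exponent. *)
have Ub (r : R) : r != 0 -> U (b + r *: frame 0).
  move=> r0; rewrite /mobius_domain; case: ifP => // _ /eqP.
  rewrite -subr_eq0 addrAC subrr add0r scaler_eq0 (negbTE r0)/= -dot_eq0.
  by rewrite dot_frameii oner_eq0.
have dQ0 r : r != 0 -> dQ (b + r *: frame 0) = 0.
  by move=> r0; apply: (tauE _ (Ub r r0)).2.1; exact: tau0 (Ub r r0).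
(* Comparing [dQ] at the points [r = 1] and [r = 2] eliminates its constant part. *)
have c0 : c = 0.
  have two0 : 2 != 0 :> R by rewrite pnatr_eq0.
  have := congr1 (fun v : 'cV[R]_4 => v 0 0)
    (etrans (dQ0 1 (oner_neq0 _)) (esym (dQ0 2 two0))).
  by rewrite /dQ !mxE /=; lra.
move: c0; rewrite /c; case: eqVneq => [-> /eqP|_ /eqP c0].
  by rewrite mulf_eq0 sqrf_eq0 (negbTE alpha0) orbF => /eqP.
by move: c0; rewrite (negbTE (space_form_neq0 _ k0 a)).
Qed.

End MobiusBiharmonic.

(** * The flat and round metrics as space forms, and the conclusion *)

Lemma euclidean_space_form {R : realType} {n : nat} :
  @euclidean_metric R n = space_form_metric 1 0.
Proof.
by apply/funext => y; rewrite /space_form_metric mul0r addr0 expr1n divr1.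
Qed.

Lemma spherical_space_form {R : realType} {n : nat} :
  @spherical_metric R n = space_form_metric 4 1.
Proof.
by apply/funext => y; rewrite /spherical_metric /space_form_metric enorm_sqr mul1r.
Qed.

Theorem corollary5p2 (R : realType) (a b : 'cV[R]_4) (alpha : R)
    (A : 'M[R]_4) (eps : nat)
    (halpha : alpha != 0)
    (hA : A^T *m A = 1%:M)
    (heps : eps = 0%N \/ eps = 2%N) :
  let phi := mobius a b alpha A eps in
  let U := mobius_domain b eps in
  (biharmonic euclidean_metric euclidean_metric phi U /\
   (proper_biharmonic euclidean_metric euclidean_metric phi U <-> eps <> 0%N)) /\
  proper_biharmonic euclidean_metric spherical_metric phi U.
Proof.
move=> phi U.
have [eb eh] : biharmonic euclidean_metric euclidean_metric phi U /\
    (Defs.harmonic euclidean_metric euclidean_metric phi U <-> eps = 0%N).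
  rewrite [X in biharmonic _ X]euclidean_space_form.
  rewrite [X in Defs.harmonic _ X]euclidean_space_form.
  have [fb fh] := @mobius_biharmonic R a b alpha A eps halpha hA heps 1 0
    (oner_neq0 _) (lexx _).
  by split => //; split=> [/fh[]//|e0]; apply/fh.
have four0 : 4 != 0 :> R by rewrite pnatr_eq0.
have [sb sh] := @mobius_biharmonic R a b alpha A eps halpha hA heps 4 1 four0 ler01.
rewrite spherical_space_form; split; last first.
  by split=> // /sh[_ /eqP]; rewrite oner_eq0.
split=> //; split=> [[_ nh] /eh//|e0]; split=> // /eh; exact: e0.
Qed.
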